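(* Let $\Omega=\Omega(u,v)$ be a solution in $E^4$ of the Betchov-Da Rios equation $\Omega_v=\Omega_u\times\Omega_{uu}\times\Omega_{uuu}$ whose $u$-parameter curves are unit speed, with ED$^2$-frame field $\{T,E,D,N\}$ and associated functions $\kappa,\sigma,\tau$ (notation and standing assumptions as in the context). Then the Gaussian curvature of the soliton surface $S:\Omega=\Omega(u,v)$ is $$K=-\frac{\kappa\,(4\kappa_u\tau_u+\kappa\tau_{uu})+2\tau\,(\kappa_u^2+\kappa\kappa_{uu})}{\kappa^2\tau}.$$
   Context: $E^4$ is Euclidean 4-space with inner product $\langle\cdot,\cdot\rangle$, and $x\times y\times z$ is the usual alternating ternary vector product of $E^4$ (with a fixed sign convention, e.g. $\langle w,x\times y\times z\rangle=\det(w,x,y,z)$). Subscripts $u,v$ denote partial derivatives. All functions are assumed sufficiently smooth on an open domain of the $(u,v)$-plane. ED$^2$-frame field: for each $v$, the unit speed curve $u\mapsto\Omega(u,v)$ lies on an oriented hypersurface of $E^4$; $T=\Omega_u$ and $N(u,v)$ is the unit normal of the hypersurface at $\Omega(u,v)$. One is in the case where $\{N,T,\Omega_{uu}\}$ is linearly dependent; $E$ is the normalization of $\Omega_{uuu}-\langle\Omega_{uuu},N\rangle N-\langle\Omega_{uuu},T\rangle T$ (assumed nonzero), and $D=N\times T\times E$. Associated functions: $\kappa=\kappa_n=\langle T_u,N\rangle$, $\sigma=\kappa_g^2=\langle E_u,D\rangle$ (the superscript in $\kappa_g^2$ is an index, not a power), $\tau=\tau_g^1=\langle E_u,N\rangle$.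 The frame satisfies $T_u=\kappa N$, $E_u=\sigma D+\tau N$, $D_u=-\sigma E$, $N_u=-\kappa T-\tau E$. Standing assumption: $\kappa$ and $\tau$ are nowhere zero. The orthonormal normal frame of $S$ is $\{E,N\}$, and $K=\det A_E+\det A_N$, where $A_E,A_N$ are the shape operators of $S$ with respect to the normal fields $E$ and $N$ (this is the usual Gaussian curvature). *)

(* Defs.v *)
From HB Require Import structures.
From mathcomp Require Export all_boot all_order all_algebra.
From mathcomp Require Export all_classical all_reals all_analysis.
Export numFieldNormedType.Exports.

Set Implicit Arguments.
Unset Strict Implicit.
Unset Printing Implicit Defensive.

Import Order.TTheory GRing.Theory Num.Theory.

Local Open Scope classical_set_scope.
Local Open Scope ring_scope.

(* C^k on A, meant for open A.  For finite-dimensional V this is the usual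
   notion: at each order 'D_w f for all directions w amounts to the partial
   derivatives, and Frechet differentiability follows from their continuity. *)
Fixpoint class_C (R : realType) (V W : normedModType R) (k : nat)
    (A : set V) (f : V -> W) : Prop :=
  match k with
  | 0 => forall x, A x -> {for x, continuous f}
  | k'.+1 => (forall x, A x -> differentiable f x) /\
             (forall w : V, class_C k' A (fun x => 'D_w f x))
  end.

(* The (u, v)-plane is 'rV[R]_2 and E^4 is 'rV[R]_4.  The library norm on row
   vectors is the sup norm: it is used for the topology only, Euclidean
   lengths and angles come from dot. *)
Definition dot (R : realType) (n : nat) (x y : 'rV[R]_n) : R :=
  \sum_(i < n) x 0 i * y 0 i.

Definition normalize (R : realType) (n : nat) (x : 'rV[R]_n) : 'rV[R]_n :=
  (Num.sqrt (dot x x))^-1 *: x.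

Definition det4 (R : realType) (w x y z : 'rV[R]_4) : R :=
  \det (col_mx w (col_mx x (col_mx y z)) : 'M[R]_4).

(* The vector with dot w (cross3 x y z) = det4 w x y z for every w. *)
Definition cross3 (R : realType) (x y z : 'rV[R]_4) : 'rV[R]_4 :=
  \row_i det4 (delta_mx 0 i) x y z.

Definition Du (R : realType) (W : normedModType R) (f : 'rV[R]_2 -> W) :
    'rV[R]_2 -> W :=
  fun p => 'D_(delta_mx 0 0 : 'rV[R]_2) f p.

Definition Dv (R : realType) (W : normedModType R) (f : 'rV[R]_2 -> W) :
    'rV[R]_2 -> W :=
  fun p => 'D_(delta_mx 0 1 : 'rV[R]_2) f p.

Definition gradient (R : realType) (n : nat) (F : 'rV[R]_n -> R)
    (x : 'rV[R]_n) : 'rV[R]_n :=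
  \row_i 'D_(delta_mx 0 i : 'rV[R]_n) F x.

(* M is locally a regular level set; nu (relevant on M only) is its unit
   normal field.  Having one global nu that is a normalized gradient near
   every point is the orientation, and makes nu continuous on M. *)
Definition oriented_hypersurface (R : realType) (M : set 'rV[R]_4)
    (nu : 'rV[R]_4 -> 'rV[R]_4) : Prop :=
  forall x, M x -> exists (W : set 'rV[R]_4) (F : 'rV[R]_4 -> R),
    [/\ open W /\ W x,
        class_C 1 W F,
        forall y, W y -> gradient F y != 0,
        forall y, W y -> (M y <-> F y = 0)
      & forall y, W y -> M y -> nu y = normalize (gradient F y)].

(* sigma is the geodesic curvature kappa_g^2 (upper index) and tau the
   geodesic torsion tau_g^1.  The equations T_u = kappa N,
   E_u = sigma D + tau N, D_u = - sigma E, N_u = - kappa T - tau E are not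
   listed: where kappa <> 0 they follow from the fields below when Omega and N
   are smooth enough. *)
Record ED2_frame_field (R : realType) (U : set 'rV[R]_2)
    (Omega T E D N : 'rV[R]_2 -> 'rV[R]_4) (kappa sigma tau : 'rV[R]_2 -> R) :
    Prop := {
  ed2_T : forall p, U p -> T p = Du Omega p;
  ed2_unit_speed : forall p, U p -> dot (T p) (T p) = 1;
  ed2_N : forall v : R, exists (M : set 'rV[R]_4) (nu : 'rV[R]_4 -> 'rV[R]_4),
    oriented_hypersurface M nu /\
    forall p, U p -> p 0 1 = v -> M (Omega p) /\ N p = nu (Omega p);
  ed2_dependent : forall p, U p -> ~~ free [:: N p; T p; Du (Du Omega) p];
  ed2_E : forall p, U p ->
    let Ouuu := Du (Du (Du Omega)) p in
    let w := Ouuu - dot Ouuu (N p) *: N p - dot Ouuu (T p) *: T p in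
    w != 0 /\ E p = normalize w;
  ed2_D : forall p, U p -> D p = cross3 (N p) (T p) (E p);
  ed2_kappa : forall p, U p -> kappa p = dot (Du T p) (N p);
  ed2_sigma : forall p, U p -> sigma p = dot (Du E p) (D p);
  ed2_tau : forall p, U p -> tau p = dot (Du E p) (N p)
}.

Definition Betchov_Da_Rios (R : realType) (U : set 'rV[R]_2)
    (Omega : 'rV[R]_2 -> 'rV[R]_4) : Prop :=
  forall p, U p ->
    Dv Omega p = cross3 (Du Omega p) (Du (Du Omega) p) (Du (Du (Du Omega)) p).

(* Matrix, in the basis (Omega_u, Omega_v) of the tangent plane, of the shape
   operator A_xi X = - (D_X xi)^tan for a normal field xi along Omega.  With
   J := 'J Omega p, whose rows are Omega_u and Omega_v, a vector w of E^4 has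
   tangential part w *m J^T *m (J *m J^T)^-1 *m J, where J *m J^T is the first
   fundamental form; row vectors act on the left.  Meaningful only where
   Omega is an immersion, since invmx of a singular matrix is a dummy. *)
Definition shape_operator (R : realType) (Omega xi : 'rV[R]_2 -> 'rV[R]_4)
    (p : 'rV[R]_2) : 'M[R]_2 :=
  - ('J xi p *m ('J Omega p)^T *m invmx ('J Omega p *m ('J Omega p)^T)).

Definition Gaussian_curvature (R : realType)
    (Omega xi1 xi2 : 'rV[R]_2 -> 'rV[R]_4) (p : 'rV[R]_2) : R :=
  \det (shape_operator Omega xi1 p) + \det (shape_operator Omega xi2 p).

(* Main.v *)
Require Import Defs.
From mathcomp Require Import ring.
Import Order.TTheory GRing.Theory Num.Theory.
Local Open Scope classical_set_scope.
Local Open Scope ring_scope.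

Set Implicit Arguments.
Unset Strict Implicit.
Unset Printing Implicit Defensive.

(* Put g = kappa^2 tau.  The frame equations turn the Betchov-Da Rios equation
   into Omega_v = g D, so the first fundamental form is diag(1, g^2), and
   det A_E = - sigma^2 while det A_N = - kappa <N_v, D> / g.  Equality of mixed
   partial derivatives gives (kappa N)_v = Omega_uuv = (g D)_uu, whose
   D-component reads kappa <N_v, D> = g_uu - g sigma^2.  Hence K = - g_uu / g.
   On the way, Omega_uuu - <Omega_uuu, N> N - <Omega_uuu, T> T = - kappa tau E,
   so kappa tau is minus the length of this vector: this is what makes tau, and
   then D = Omega_v / g, smooth. *)

(** * Functions of class C^k *)

Section ClassC.
Context {R : realType} {V : normedModType R}.
Implicit Types (A : set V) (k : nat).

(** Near [x] the function [g] has the same first-order expansion as [f], with the continuous linear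
    map ['d f x]; uniqueness of the differential identifies that map with ['d g x]. *)
Lemma near_eq_differentiable (W : normedModType R) (f g : V -> W) (x : V) :
  (\near x, f x = g x) -> differentiable f x -> differentiable g x.
Proof.
move=> fg /diff_locallyP[dfc fE].
have gE : g \o shift x = cst (g x) + 'd f x +o_ 0 id.
  rewrite -(nbhs_singleton fg); apply/eqaddoP => e e0.
  move/eqaddoP : fE => /(_ e e0); apply: filter_app.
  have : \forall h \near 0, f (h + x) = g (h + x).
    move: fg; rewrite (near_shift 0 x) /=; apply: filter_app; near=> h.
    by rewrite /= subr0 addrC.
  apply: filter_app; near=> h => fgh.
  by rewrite /= !fctE /= fgh.
have dgE := diff_unique dfc gE.
by apply/diff_locallyP; rewrite dgE.
Unshelve. all: by end_near. Qed.

(** Openness of [A] turns equality on [A] into equality near each of its points, so all iterated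
    derivatives agree on [A]. This transfers regularity to the frame functions, which are only
    prescribed on the domain. *)
Lemma class_C_ext (W : normedModType R) k A (f g : V -> W) :
  open A -> (forall x, A x -> f x = g x) -> class_C k A f -> class_C k A g.
Proof.
move=> Ao; elim: k f g => [|k IH] f g fg /=.
  move=> fc x Ax; have nfg : \near x, f x = g x.
    by near=> y; apply: fg; near: y; exact: open_nbhs_nbhs.
  rewrite /prop_for /continuous_at -(fg _ Ax).
  by apply: cvg_trans (fc x Ax); exact: near_eq_cvg.
move=> [fd fD]; split=> [x Ax|w].
  apply: near_eq_differentiable (fd x Ax).
  by near=> y; apply: fg; near: y; exact: open_nbhs_nbhs.
apply: IH (fD w) => x Ax; apply: near_eq_derive.
by near=> y; apply: fg; near: y; exact: open_nbhs_nbhs.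
Unshelve. all: by end_near. Qed.

Lemma class_CS (W : normedModType R) k A (f : V -> W) :
  class_C k.+1 A f -> class_C k A f.
Proof.
elim: k f => [|k IH] f [fd fD] /=; last by split=> // w; exact: IH.
by move=> x Ax; apply: differentiable_continuous; exact: fd.
Qed.

Lemma class_C_le (W : normedModType R) j k A (f : V -> W) :
  (j <= k)%N -> class_C k A f -> class_C j A f.
Proof.
move=> /subnK <-; elim: (k - j)%N => // n IH; rewrite addSn => /class_CS.
exact: IH.
Qed.

Lemma class_C_cst (W : normedModType R) k A (c : W) : class_C k A (fun=> c).
Proof.
elim: k c => [|k IH] c /=; first by move=> x _; exact: cvg_cst.
split=> [x _|w]; first exact: differentiable_cst.
suff -> : 'D_w (fun _ : V => c) = fun=> 0 by [].
by apply/funext => x; exact: derive_cst.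
Qed.

Lemma class_C_diff (W : normedModType R) k A (f : V -> W) x :
  class_C k.+1 A f -> A x -> differentiable f x.
Proof. by move=> [+ _]; exact. Qed.

Lemma class_CD (W : normedModType R) k A (f g : V -> W) : open A ->
  class_C k A f -> class_C k A g -> class_C k A (fun x => f x + g x).
Proof.
move=> Ao; elim: k f g => [|k IH] f g /=.
  by move=> fc gc x Ax; apply: cvgD; [exact: fc|exact: gc].
move=> [fd fD] [gd gD]; split=> [x Ax|w].
  by apply: differentiableD; [exact: fd|exact: gd].
apply: class_C_ext (IH _ _ (fD w) (gD w)) => //= x Ax.
by rewrite -deriveD//; apply: diff_derivable; [exact: fd|exact: gd].
Qed.

Lemma class_CM k A (f g : V -> R) : open A ->
  class_C k A f -> class_C k A g -> class_C k A (fun x => f x * g x).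
Proof.
move=> Ao; elim: k f g => [|k IH] f g fC gC /=.
  by move=> x Ax; apply: cvgM; [exact: fC|exact: gC].
have fC' := class_CS fC; have gC' := class_CS gC.
move: fC gC => [fd fD] [gd gD]; split=> [x Ax|w].
  by apply: differentiableM; [exact: fd|exact: gd].
apply: class_C_ext (class_CD Ao (IH _ _ fC' (gD w)) (IH _ _ gC' (fD w))) => //= x Ax.
by rewrite -[in RHS]/(f * g) deriveM//; apply: diff_derivable; [exact: fd|exact: gd].
Qed.

Lemma class_CN k A (f : V -> R) : open A ->
  class_C k A f -> class_C k A (fun x => - f x).
Proof.
move=> Ao fC; have cC := class_CM Ao (@class_C_cst R k A (-1)) fC.
by apply: class_C_ext cC => // x _ /=; rewrite mulN1r.
Qed.

Lemma class_C_sum (I : Type) (s : seq I) k A (f : I -> V -> R) : open A ->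
  (forall i, class_C k A (f i)) -> class_C k A (fun x => \sum_(i <- s) f i x).
Proof.
move=> Ao fC; elim: s => [|i s IH].
  by apply: (class_C_ext Ao _ (class_C_cst k A 0)) => // x _; rewrite big_nil.
by apply: (class_C_ext Ao _ (class_CD Ao (fC i) IH)) => // x _; rewrite big_cons.
Qed.

(** Induction on [k]: the derivative of 1/f is - (1/f)^2 f', a product of functions already known to
    be of class C^k. *)
Lemma class_CV k A (f : V -> R) : open A -> (forall x, A x -> f x != 0) ->
  class_C k A f -> class_C k A (fun x => (f x)^-1).
Proof.
move=> Ao f0; elim: k => [|k IH] fC /=.
  by move=> x Ax; apply: cvgV; [exact: f0|exact: fC].
have iC := IH (class_CS fC); move: fC => [fd fD]; split=> [x Ax|w].
  by apply: differentiableV; [exact: fd|exact: f0].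
have iifC := class_CM Ao (class_CM Ao iC iC) (fD w).
apply: (class_C_ext Ao _ (class_CN Ao iifC)) => //= x Ax.
rewrite deriveV//; [|exact: f0|exact/diff_derivable/fd].
by rewrite /= -exprVn expr2 -mulNr.
Qed.

Lemma differentiable_sqrt (x : R) : 0 < x -> differentiable (@Num.sqrt R) x.
Proof. by move=> x0; apply/derivable1_diffP; have [] := is_derive1_sqrt x0. Qed.

(** Same induction as for the inverse, with derivative f' / (2 sqrt f); positivity of [f] keeps the
    values away from the singularity of the square root at 0. *)
Lemma class_C_sqrt k A (f : V -> R) : open A -> (forall x, A x -> 0 < f x) ->
  class_C k A f -> class_C k A (fun x => Num.sqrt (f x)).
Proof.
move=> Ao f0; elim: k => [|k IH] fC.
  move=> x Ax /=; apply: (@continuous_comp _ _ _ f Num.sqrt); first exact: fC.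
  exact: sqrt_continuous.
have sC := IH (class_CS fC); move: fC => [fd fD].
have s0 x : A x -> 2 * Num.sqrt (f x) != 0.
  by move=> Ax; rewrite mulf_neq0// gt_eqF// sqrtr_gt0 f0.
split=> [x Ax|w].
  apply: (@differentiable_comp _ _ _ _ f Num.sqrt); first exact: fd.
  exact/differentiable_sqrt/f0.
have iC := class_CV Ao s0 (class_CM Ao (class_C_cst k A (2 : R)) sC).
apply: (class_C_ext Ao _ (class_CM Ao (fD w) iC)) => //= x Ax.
have ds := differentiable_sqrt (f0 x Ax).
rewrite [RHS](_ : _ = 'D_w (Num.sqrt \o f) x)// [in RHS]deriveE; last first.
  by apply: differentiable_comp => //; exact: fd.
rewrite diff_comp//=; last exact: fd.
rewrite diff1E// -deriveE; last exact: fd.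
by rewrite derive1E derive_sqrt//; exact: f0.
Qed.

Lemma differentiable_rVP n (f : V -> 'rV[R]_n) x :
  differentiable f x <-> forall i, differentiable (fun y => f y 0 i) x.
Proof.
split=> [fd i|fd].
  apply: (@differentiable_comp _ _ _ _ f (fun M : 'rV_n => M 0 i)) => //.
  exact: differentiable_coord.
rewrite (_ : f = \sum_(i < n) (fun y => f y 0 i *: delta_mx 0 i)); last first.
  apply/funext => y; rewrite fct_sumE [LHS]row_sum_delta.
  by [].
by apply: differentiable_sum => i; exact: differentiableZl.
Qed.

Lemma derive_rV n (f : V -> 'rV[R]_n) w x i :
  differentiable f x -> 'D_w f x 0 i = 'D_w (fun y => f y 0 i) x.
Proof. by move=> fd; rewrite derive_mx ?mxE//; exact: diff_derivable. Qed.

Lemma class_C_rVP n k A (f : V -> 'rV[R]_n) : open A ->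
  class_C k A f <-> forall i, class_C k A (fun y => f y 0 i).
Proof.
move=> Ao; elim: k f => [|k IH] f.
  split=> [fc i x Ax|fc x Ax].
    apply: (@continuous_comp _ _ _ f (fun M : 'rV_n => M 0 i)); first exact: fc.
    exact: coord_continuous.
  apply/cvgrPdist_le => /= e e0; near=> y.
  (* The norm is the sup norm, so finitely many coordinate estimates suffice. *)
  rewrite [leLHS]/Num.Def.normr/= mx_normrE (bigmax_le _ (ltW e0))//= => -[i j] _.
  rewrite !mxE/= ord1; move: j; near: y; apply: filter_forall => j.
  by have /cvgrPdist_le := fc j x Ax; apply.
split=> [[fd fD] i|fC] /=.
  split=> [x Ax|w]; first by have /differentiable_rVP := fd x Ax; exact.
  apply: (class_C_ext Ao _ ((IH _).1 (fD w) i)) => //= x Ax.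
  by rewrite derive_rV//; exact: fd.
have fd x : A x -> differentiable f x.
  by move=> Ax; apply/differentiable_rVP => i; exact: (class_C_diff (fC i)).
split=> // w; apply/IH => i; have [_ fiD] := fC i.
apply: (class_C_ext Ao _ (fiD w)) => //= x Ax.
by rewrite derive_rV//; exact: fd.
Unshelve. all: by end_near. Qed.

Lemma class_C_dot n k A (f g : V -> 'rV[R]_n) : open A ->
  class_C k A f -> class_C k A g -> class_C k A (fun x => dot (f x) (g x)).
Proof.
move=> Ao /class_C_rVP fC /class_C_rVP gC; apply: class_C_sum => // i.
by apply: class_CM => //; [exact: fC|exact: gC].
Qed.

Lemma class_CZ n k A (a : V -> R) (f : V -> 'rV[R]_n) : open A ->
  class_C k A a -> class_C k A f -> class_C k A (fun x => a x *: f x).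
Proof.
move=> Ao aC /class_C_rVP fC; apply/class_C_rVP => // i.
by apply: (class_C_ext Ao _ (class_CM Ao aC (fC Ao i))) => // x _; rewrite mxE.
Qed.

Lemma derive_dot n (f g : V -> 'rV[R]_n) w x :
  differentiable f x -> differentiable g x ->
  'D_w (fun y => dot (f y) (g y)) x = dot ('D_w f x) (g x) + dot (f x) ('D_w g x).
Proof.
move=> fd gd; rewrite /dot.
have fi i : derivable (fun y => f y 0 i) x w.
  by apply: diff_derivable; have /differentiable_rVP := fd; exact.
have gi i : derivable (fun y => g y 0 i) x w.
  by apply: diff_derivable; have /differentiable_rVP := gd; exact.
rewrite (_ : (fun y => _) = \sum_(i < n) ((fun y => f y 0 i) * (fun y => g y 0 i))).
  rewrite derive_sum => [|i]; last exact: derivableM.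
  rewrite -big_split; apply: eq_bigr => i _ /=.
  by rewrite deriveM// !derive_rV//= addrC; congr (_ + _); exact: mulrC.
by apply/funext => y; rewrite fct_sumE.
Qed.

Lemma deriveZ_rV n (a : V -> R) (f : V -> 'rV[R]_n) w x :
  differentiable a x -> differentiable f x ->
  'D_w (fun y => a y *: f y) x = 'D_w a x *: f x + a x *: 'D_w f x.
Proof.
move=> ad fd; have fi i : differentiable (fun y => f y 0 i) x.
  by have /differentiable_rVP := fd; exact.
apply/rowP => i; rewrite derive_rV; last first.
  apply/differentiable_rVP => j.
  rewrite (_ : (fun y => _) = a * (fun y => f y 0 j)); first exact: differentiableM.
  by apply/funext => y; rewrite mxE.
rewrite (_ : (fun y => _) = a * (fun y => f y 0 i)); last first.
  by apply/funext => y; rewrite mxE.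
rewrite deriveM; [|exact: diff_derivable..].
by rewrite !mxE derive_rV//= addrC [_ *: 'D_w a x]mulrC.
Qed.

End ClassC.

(** * Symmetry of second derivatives *)

Section Clairaut.
Context {R : realType} {V : normedModType R}.

Lemma is_derive_line (W : normedModType R) (f : V -> W) (p v : V) (t : R) :
  differentiable f (p + t *: v) ->
  is_derive t 1 (fun s : R => f (p + s *: v)) ('D_v f (p + t *: v)).
Proof.
move=> fd; have ld : is_diff t (fun s : R => p + s *: v) (fun s : R => s *: v).
  have := is_diffD (is_diff_cst p t) (is_diff_scalel t v).
  rewrite [X in is_diff _ _ X](_ : _ = (fun s => s *: v))//.
  by apply/funext => s; rewrite !fctE add0r.
have [ld1 ld2] := ld.
have fld : differentiable (f \o (fun s : R => p + s *: v)) t.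
  exact: differentiable_comp.
split; first exact: diff_derivable.
by rewrite deriveE// diff_comp//= ld2 scale1r -deriveE.
Qed.

Lemma MVT_line (f : V -> R) (p v : V) (h : R) : 0 < h ->
  (forall t, 0 <= t <= h -> differentiable f (p + t *: v)) ->
  exists2 t, 0 <= t <= h & f (p + h *: v) - f p = h * 'D_v f (p + t *: v).
Proof.
move=> h0 fd.
have fl t : t \in `[0, h] ->
    is_derive t 1 (fun s : R => f (p + s *: v)) ('D_v f (p + t *: v)).
  by rewrite in_itv/= => /fd; exact: is_derive_line.
have cl : {within `[0, h], continuous (fun s : R => f (p + s *: v))}.
  by apply: derivable_within_continuous => t /fl[].
have fo t (th : t \in `]0, h[) := fl t (subset_itv_oo_cc th).
have [t th] := MVT h0 fo cl.
rewrite scale0r addr0 subr0 mulrC => tE; exists t => //.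
by move: th; rewrite in_itv/= => /andP[/ltW-> /ltW->].
Qed.

Lemma derive_translate (f : V -> R) (a v x : V) :
  'D_v (fun y => f (y + a)) x = 'D_v f (x + a).
Proof.
rewrite /derive; set F := fun h : R => _; set G := fun h : R => _.
by suff -> : F = G by []; apply/funext => h; rewrite /F /G /= addrA.
Qed.

Lemma differentiable_translate (f : V -> R) (a x : V) :
  differentiable f (x + a) -> differentiable (fun y => f (y + a)) x.
Proof.
move=> fd; apply: (@differentiable_comp _ _ _ _ (fun y => y + a) f).
  exact: differentiableD.
by [].
Qed.

(** The mean value theorem is used twice: along [v] for the increment of [f] in the direction
    [h *: w], then along [w] for ['D_v f]. *)
Lemma second_difference (f : V -> R) (p v w : V) (h : R) : 0 < h ->
  (forall s t, 0 <= s <= h -> 0 <= t <= h ->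
    differentiable f (p + s *: v + t *: w) /\
    differentiable ('D_v f) (p + s *: v + t *: w)) ->
  exists s t, [/\ 0 <= s <= h, 0 <= t <= h &
    f (p + h *: v + h *: w) - f (p + h *: v) - (f (p + h *: w) - f p) =
    h * (h * 'D_w ('D_v f) (p + s *: v + t *: w))].
Proof.
move=> h0 fd; have h00 : 0 <= (0 : R) <= h by rewrite lexx ltW.
have hh : 0 <= h <= h by rewrite lexx ltW.
have fd0 s : 0 <= s <= h -> differentiable f (p + s *: v).
  by move=> sh; have [] := fd s 0 sh h00; rewrite scale0r addr0.
pose F x := f (x + h *: w) - f x.
have [s sh|s sh] := @MVT_line F p v h h0.
  apply: differentiableB (fd0 s sh); apply: differentiable_translate.
  by have [] := fd s h sh hh.
rewrite {1 2}/F => FE.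
have [t th|t th tE] := @MVT_line ('D_v f) (p + s *: v) w h h0.
  by have [] := fd s t sh th.
exists s, t; split=> //; rewrite FE -tE; congr (_ * _).
rewrite (deriveB (f := fun x => f (x + h *: w))) ?derive_translate//.
  by apply/diff_derivable/differentiable_translate; have [] := fd s h sh hh.
exact/diff_derivable/fd0.
Qed.

(** The second difference of [f] over a small parallelogram is symmetric in [v] and [w]. It equals
    h^2 times either mixed derivative at some nearby point, and continuity of both at [p] brings
    their values at [p] within any [e] of each other. *)
Lemma derive_comm (A : set V) (f : V -> R) (v w p : V) :
  open A -> A p -> class_C 2 A f -> 'D_w ('D_v f) p = 'D_v ('D_w f) p.
Proof.
move=> Ao Ap [fd fD]; have fDd u x : A x -> differentiable ('D_u f) x.
  by have [+ _] := fD u; exact.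
have fc u u' : {for p, continuous ('D_u' ('D_u f))}.
  by have [_ /(_ u')] := fD u; exact.
apply/eqP; rewrite -subr_eq0 -normr_le0; apply/ler_addgt0Pl => e e0; rewrite addr0.
have e2 : 0 < e / 2 by rewrite divr_gt0.
have : nbhs p [set x | [/\ A x, `|'D_w ('D_v f) p - 'D_w ('D_v f) x| < e / 2 &
                          `|'D_v ('D_w f) p - 'D_v ('D_w f) x| < e / 2]].
  have /cvgrPdist_lt/(_ _ e2) c1 := fc v w.
  have /cvgrPdist_lt/(_ _ e2) c2 := fc w v.
  have /filterI/(_ c1)/filterI/(_ c2) : nbhs p A by exact: open_nbhs_nbhs.
  by apply: filterS => x [[Ax x1] x2]; exact: And3 Ax x1 x2.
move=> /nbhs_ballP[r /= r0 rB].
(* With this [h] the parallelogram with sides [h *: v] and [h *: w] lies in the ball of radius [r];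
   the summand 1 keeps the denominator positive and the inclusion strict. *)
pose h := r / (`|v| + `|w| + 1).
have d0 : 0 < `|v| + `|w| + 1 by rewrite ltr_wpDl// addr_ge0.
have h0 : 0 < h by rewrite divr_gt0.
have B s t : 0 <= s <= h -> 0 <= t <= h -> ball p r (p + s *: v + t *: w).
  move=> /andP[s0 sh] /andP[t0 th].
  rewrite -ball_normE /= opprD addrA opprD addrA subrr add0r -opprD normrN.
  apply: (@le_lt_trans _ _ (h * (`|v| + `|w|))).
    rewrite (le_trans (ler_normD _ _))// !normrZ mulrDr lerD// ler_wpM2r// ger0_norm//.
  by rewrite /h mulrAC ltr_pdivrMr// ltr_pM2l// ltrDl.
have [s1 [t1 [sh1 th1 E1]]] := @second_difference f p v w h h0 (fun s t sh th =>
   conj (fd _ (let: And3 a _ _ := rB _ (B s t sh th) in a))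
        (fDd _ _ (let: And3 a _ _ := rB _ (B s t sh th) in a))).
have B' s t : 0 <= s <= h -> 0 <= t <= h -> ball p r (p + s *: w + t *: v).
  by move=> sh th; rewrite addrAC; exact: B.
have [s2 [t2 [sh2 th2 E2]]] := @second_difference f p w v h h0 (fun s t sh th =>
   conj (fd _ (let: And3 a _ _ := rB _ (B' s t sh th) in a))
        (fDd _ _ (let: And3 a _ _ := rB _ (B' s t sh th) in a))).
have [_ d1 _] := rB _ (B _ _ sh1 th1).
have [_ _ d2] := rB _ (B' _ _ sh2 th2).
have close (a b c : R) : `|a - c| < e / 2 -> `|b - c| < e / 2 -> `|a - b| <= e.
  move=> ac bc; rewrite -(subrK c a) -addrA (splitr e) (le_trans (ler_normD _ _))//.
  by rewrite lerD// ltW// distrC.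
apply: close d2.
suff <- : 'D_w ('D_v f) (p + s1 *: v + t1 *: w) =
    'D_v ('D_w f) (p + s2 *: w + t2 *: v) by exact: d1.
apply: (mulfI (lt0r_neq0 h0)); apply: (mulfI (lt0r_neq0 h0)).
(* Exchanging the two middle corners shows that both orders of differencing give the same number. *)
have sub_swap (a b c d : R) : a - b - (c - d) = a - c - (b - d) by ring.
apply: (etrans (esym E1)).
rewrite sub_swap.
rewrite [p + h *: v + h *: w]addrAC.
exact: E2.
Unshelve. all: by end_near. Qed.

Lemma derive_comm_rV n (A : set V) (f : V -> 'rV[R]_n) (v w p : V) :
  open A -> A p -> class_C 2 A f -> 'D_w ('D_v f) p = 'D_v ('D_w f) p.
Proof.
move=> Ao Ap fC; apply/rowP => i.
have fd x : A x -> differentiable f x by move=> Ax; exact: class_C_diff fC Ax.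
have fDd u x : A x -> differentiable ('D_u f) x.
  by move=> Ax; have [_ /(_ u)[+ _]] := fC; exact.
have fE u x : A x -> 'D_u f x 0 i = 'D_u (fun y => f y 0 i) x.
  by move=> Ax; apply: derive_rV; exact: fd.
have dE u u' : 'D_u' ('D_u f) p 0 i = 'D_u' ('D_u (fun y => f y 0 i)) p.
  apply: etrans (derive_rV u' i (fDd u p Ap)) _.
  apply: near_eq_derive.
  near=> x; apply: fE; near: x; exact: open_nbhs_nbhs.
apply: etrans (dE v w) (etrans _ (esym (dE w v))).
by apply: (derive_comm v w Ao Ap); have /class_C_rVP := fC; apply.
Unshelve. all: by end_near. Qed.

End Clairaut.

(** * Vector algebra of E^4 *)

Section Dot.
Context {R : realType} {n : nat}.
Implicit Types (x y z : 'rV[R]_n) (a : R).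

Lemma dotC x y : dot x y = dot y x.
Proof. by apply: eq_bigr => i _; rewrite mulrC. Qed.

Lemma dotDl x y z : dot (x + y) z = dot x z + dot y z.
Proof. by rewrite -big_split; apply: eq_bigr => i _; rewrite mxE mulrDl. Qed.

Lemma dotZl a x y : dot (a *: x) y = a * dot x y.
Proof. by rewrite mulr_sumr; apply: eq_bigr => i _; rewrite mxE mulrA. Qed.

Lemma dotNl x y : dot (- x) y = - dot x y.
Proof. by rewrite -scaleN1r dotZl mulN1r. Qed.

Lemma dotDr x y z : dot z (x + y) = dot z x + dot z y.
Proof. by rewrite !(dotC z) dotDl. Qed.

Lemma dotZr a x y : dot x (a *: y) = a * dot x y.
Proof. by rewrite !(dotC x) dotZl. Qed.

Lemma dotNr x y : dot x (- y) = - dot x y.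
Proof. by rewrite !(dotC x) dotNl. Qed.

Lemma dot0l x : dot 0 x = 0.
Proof. by rewrite -(scale0r 0) dotZl mul0r. Qed.

Definition dotE := (dotDl, dotDr, dotNl, dotNr, dotZl, dotZr).

Lemma dot_gt0 x : x != 0 -> 0 < dot x x.
Proof.
move=> x0; rewrite lt_def sumr_ge0 ?andbT => [|i _]; last by rewrite -expr2 sqr_ge0.
apply: contra_neq x0 => /eqP; rewrite psumr_eq0 => [/allP x0|i _]; last first.
  by rewrite -expr2 sqr_ge0.
apply/rowP => i; rewrite mxE; apply/eqP.
by have := x0 i (mem_index_enum i); rewrite -expr2 sqrf_eq0.
Qed.

Lemma dot_normalize x : x != 0 -> dot (normalize x) (normalize x) = 1.
Proof.
move=> /dot_gt0 x0; rewrite dotZl dotZr mulrA -invfM -expr2 sqr_sqrtr ?ltW//.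
by rewrite mulVf// gt_eqF.
Qed.

(** The matrix [M] with rows [e i] satisfies M M^T = 1; being square, it also satisfies M^T M = 1,
    and x = x M^T M is the expansion. *)
Lemma orthonormal_expansion (e : 'I_n -> 'rV[R]_n) x :
  (forall i j, dot (e i) (e j) = (i == j)%:R) ->
  x = \sum_i dot x (e i) *: e i.
Proof.
move=> eo; pose M : 'M[R]_n := \matrix_(i, j) e i 0 j.
have MMT : M *m M^T = 1%:M.
  apply/matrixP => i j; rewrite !mxE -eo.
  by apply: eq_bigr => k _; rewrite !mxE.
rewrite -[LHS]mulmx1 -(mulmx1C MMT) mulmxA mulmx_sum_row.
apply: eq_bigr => i _; congr (_ *: _); last by apply/rowP => j; rewrite !mxE.
by rewrite mxE; apply: eq_bigr => k _; rewrite !mxE.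
Qed.

End Dot.

(** * Determinants and triple products of E^4 in coordinates *)

Section E4.
Context {R : realType}.
Implicit Types x y z w : 'rV[R]_4.

Lemma sum4E (G : 'I_4 -> R) :
  \sum_i G i = G (inord 0) + G (inord 1) + G (inord 2) + G (inord 3).
Proof.
under eq_bigr do rewrite -[X in G X]inord_val.
by rewrite !big_ord_recr big_ord0 /= add0r.
Qed.

(** Entries indexed by natural numbers keep this shape under cofactor expansion: a minor is again
    such a matrix, with [bump] skipping the deleted column. *)
Lemma det_nat2 (F : nat -> nat -> R) :
  \det (\matrix_(i < 2, j < 2) F i j) = F 0 0 * F 1 1 - F 0 1 * F 1 0.
Proof.
rewrite (expand_det_row _ ord0) !big_ord_recl big_ord0 /cofactor !det_mx11 !mxE /=.
rewrite /bump /=; ring.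
Qed.

Lemma det_nat3 (F : nat -> nat -> R) :
  \det (\matrix_(i < 3, j < 3) F i j) =
  F 0 0 * (F 1 1 * F 2 2 - F 1 2 * F 2 1)
  - F 0 1 * (F 1 0 * F 2 2 - F 1 2 * F 2 0)
  + F 0 2 * (F 1 0 * F 2 1 - F 1 1 * F 2 0).
Proof.
have minorE j : row' ord0 (col' j (\matrix_(i < 3, j < 3) F i j)) =
    \matrix_(i < 2, k < 2) F i.+1 (bump j k).
  by apply/matrixP => i k; rewrite !mxE.
rewrite (expand_det_row _ ord0) !big_ord_recl big_ord0 /cofactor !minorE.
rewrite !(det_nat2 (fun i k => F i.+1 (bump _ k))) !mxE /= /bump /=; ring.
Qed.

Definition minor3 x y z (i j k : nat) : R :=
  x 0 (inord i) * (y 0 (inord j) * z 0 (inord k) - y 0 (inord k) * z 0 (inord j))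
  - x 0 (inord j) * (y 0 (inord i) * z 0 (inord k) - y 0 (inord k) * z 0 (inord i))
  + x 0 (inord k) * (y 0 (inord i) * z 0 (inord j) - y 0 (inord j) * z 0 (inord i)).

Lemma det4E (w x y z : 'rV[R]_4) :
  det4 w x y z =
  w 0 (inord 0) * minor3 x y z 1 2 3 - w 0 (inord 1) * minor3 x y z 0 2 3
  + w 0 (inord 2) * minor3 x y z 0 1 3 - w 0 (inord 3) * minor3 x y z 0 1 2.
Proof.
pose F i j := (nth 0 [:: w; x; y; z] i : 'rV[R]_4) 0 (inord j).
have FE : (col_mx w (col_mx x (col_mx y z)) : 'M[R]_4) = \matrix_(i < 4, j < 4) F i j.
  apply/matrixP => i j; rewrite [RHS]mxE /F inord_val.
  by do 3?[rewrite mxE; case: splitP => ? -> /=; rewrite ?ord1//].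
rewrite /det4 FE.
have minorE j : row' ord0 (col' j (\matrix_(i < 4, j < 4) F i j)) =
    \matrix_(i < 3, k < 3) F i.+1 (bump j k).
  by apply/matrixP => i k; rewrite !mxE.
rewrite (expand_det_row _ ord0) !big_ord_recl big_ord0 /cofactor !minorE.
rewrite !(det_nat3 (fun i k => F i.+1 (bump _ k))) !mxE /= /bump /= /F /minor3 /=; ring.
Qed.

Lemma cross3E (x y z : 'rV[R]_4) (i : 'I_4) :
  cross3 x y z 0 i =
  nth 0 [:: minor3 x y z 1 2 3; - minor3 x y z 0 2 3;
            minor3 x y z 0 1 3; - minor3 x y z 0 1 2] i.
Proof.
rewrite mxE det4E !mxE /= -!val_eqE /= !inordK//.
by case: i => [[|[|[|[|]]]] ?] //=; ring.
Qed.

Lemma dot4E (x y : 'rV[R]_4) :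
  dot x y = x 0 (inord 0) * y 0 (inord 0) + x 0 (inord 1) * y 0 (inord 1)
  + x 0 (inord 2) * y 0 (inord 2) + x 0 (inord 3) * y 0 (inord 3).
Proof. exact: sum4E. Qed.

Lemma dot_cross3l (x y z : 'rV[R]_4) :
  [/\ dot x (cross3 x y z) = 0, dot y (cross3 x y z) = 0 & dot z (cross3 x y z) = 0].
Proof. by split; rewrite dot4E !cross3E !inordK//= /minor3; ring. Qed.

(** The right-hand side is the Gram determinant of [x], [y], [z]; it equals 1 for an orthonormal
    triple. *)
Lemma dot_cross3_cross3 (x y z : 'rV[R]_4) :
  dot (cross3 x y z) (cross3 x y z) =
  dot x x * (dot y y * dot z z - dot y z ^+ 2)
  - dot x y * (dot x y * dot z z - dot y z * dot x z)
  + dot x z * (dot x y * dot y z - dot y y * dot x z).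
Proof. rewrite !dot4E !cross3E !inordK//= /minor3; ring. Qed.

(** Alternation kills the terms along [x] and [y], and exchanging the first two arguments gives the
    sign. With T, N, E for [x], [y], [z] this evaluates the right-hand side of the Betchov-Da Rios
    equation. *)
Lemma cross3_swap_combination (x y z : 'rV[R]_4) (k a b c : R) :
  cross3 x (k *: y) (a *: y + b *: x + c *: z) = - (k * c) *: cross3 y x z.
Proof.
apply/rowP => i; rewrite [RHS]mxE !cross3E /minor3 !mxE.
by case: i => [[|[|[|[|]]]] ?] //=; ring.
Qed.

End E4.

(** * Hypersurfaces and derivatives of frames *)

Section Hypersurface.
Context {R : realType}.

Lemma derive_comp_gradient (V : normedModType R) n (F : 'rV[R]_n -> R)
    (f : V -> 'rV[R]_n) (w p : V) :
  differentiable f p -> differentiable F (f p) ->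
  'D_w (F \o f) p = dot (gradient F (f p)) ('D_w f p).
Proof.
move=> fd Fd; rewrite deriveE; last exact: differentiable_comp.
rewrite diff_comp//= -(deriveE w fd); set u := 'D_w f p.
rewrite {1}(row_sum_delta u) linear_sum; apply: eq_bigr => i _.
by rewrite linearZ /= -deriveE// mxE mulrC.
Qed.

(** A directional derivative sees only the line through [p]. The restriction to that line matters
    because the hypersurface containing [Omega] may change with v. *)
Lemma derive_eq0 (V : normedModType R) (G : V -> R) (w p : V) :
  (\forall t \near (0 : R), G (p + t *: w) = 0) -> 'D_w G p = 0.
Proof.
move=> G0; have Gp : G p = 0 by have := nbhs_singleton G0; rewrite scale0r addr0.
apply: lim_near_cst => //; apply: nbhs_dnbhs; move: G0; apply: filter_app.
by near=> t => /= Gt; rewrite (addrC _ p) Gt Gp subrr scaler0.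
Unshelve. all: by end_near. Qed.

(** Near [f p] the hypersurface is the zero set of some [F], so [F \o f] vanishes along the line and
    the chain rule makes the gradient of [F] orthogonal to ['D_w f p]. *)
Lemma hypersurface_normal_orthogonal (V : normedModType R) (M : set 'rV[R]_4)
    (nu : 'rV[R]_4 -> 'rV[R]_4) (f : V -> 'rV[R]_4) (w p : V) :
  oriented_hypersurface M nu -> differentiable f p ->
  (\forall t \near (0 : R), M (f (p + t *: w))) ->
  dot (nu (f p)) (nu (f p)) = 1 /\ dot (nu (f p)) ('D_w f p) = 0.
Proof.
move=> Mnu fd Mf; have Mp : M (f p).
  by have := nbhs_singleton Mf; rewrite scale0r addr0.
have [W [F [[Wo Wp] [Fd _] F0 MF nuE]]] := Mnu _ Mp.
rewrite nuE//; split; first exact/dot_normalize/F0.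
rewrite dotZl -derive_comp_gradient//; last exact: Fd.
rewrite derive_eq0 ?mulr0//=.
have Wf : \forall t \near (0 : R), W (f (p + t *: w)).
  have lc : {for (0 : R), continuous (fun t : R => f (p + t *: w))}.
    apply: (@continuous_comp _ _ _ (fun t : R => p + t *: w) f).
      by apply: cvgD; [exact: cvg_cst|apply: cvgZl; exact: cvg_id].
    by rewrite scale0r addr0; exact: differentiable_continuous.
  by apply: lc; rewrite scale0r addr0; exact: open_nbhs_nbhs.
by apply: filterS2 Mf Wf => t Mt Wt; exact/MF.
Qed.

End Hypersurface.

(** * Product rules for identities that hold on an open set *)

Section OpenDomain.
Context {R : realType} {V : normedModType R} (A : set V).
Hypothesis A_open : open A.

Lemma derive_ext (W : normedModType R) (f g : V -> W) (w p : V) :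
  (forall q, A q -> f q = g q) -> A p -> 'D_w f p = 'D_w g p.
Proof.
move=> fg Ap; apply: near_eq_derive.
by near=> q; apply: fg; near: q; exact: open_nbhs_nbhs.
Unshelve. all: by end_near. Qed.

(** The Leibniz rule for a constant inner product moves the derivative to the other factor; the
    frame equations come from it. *)
Lemma derive_dot_cst n (f g : V -> 'rV[R]_n) (c : R) (w p : V) :
  (forall q, A q -> dot (f q) (g q) = c) -> A p ->
  differentiable f p -> differentiable g p ->
  dot ('D_w f p) (g p) = - dot (f p) ('D_w g p).
Proof.
move=> fgc Ap fd gd; apply/eqP; rewrite -addr_eq0 -derive_dot//; apply/eqP.
by rewrite (derive_ext w (g := cst c) _ Ap)//; exact: derive_cst.
Qed.

Lemma derive_dot_self n (f : V -> 'rV[R]_n) (c : R) (w p : V) :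
  (forall q, A q -> dot (f q) (f q) = c) -> A p -> differentiable f p ->
  dot ('D_w f p) (f p) = 0.
Proof.
move=> ffc Ap fd; have := derive_dot_cst w ffc Ap fd fd.
rewrite [in RHS]dotC => /eqP; rewrite -addr_eq0 -mulr2n -mulr_natr mulf_eq0.
by rewrite pnatr_eq0 orbF => /eqP.
Qed.

Lemma derive_mul (f g : V -> R) (w p : V) :
  differentiable f p -> differentiable g p ->
  'D_w (fun q => f q * g q) p = 'D_w f p * g p + f p * 'D_w g p.
Proof.
move=> fd gd; rewrite (_ : (fun q => _) = f * g)//.
rewrite deriveM; [|exact: diff_derivable..].
by rewrite addrC; congr (_ + _); exact: mulrC.
Qed.

Lemma derive_sqr_mul (a b : V -> R) (w p : V) :
  differentiable a p -> differentiable b p ->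
  'D_w (fun q => a q ^+ 2 * b q) p =
  2 * a p * 'D_w a p * b p + a p ^+ 2 * 'D_w b p.
Proof.
move=> ad bd; rewrite (_ : (fun q => _) = (fun q => a q * (a q * b q))); last first.
  by apply/funext => q; rewrite expr2 mulrA.
have abd : differentiable (fun q => a q * b q) p by exact: differentiableM.
rewrite !derive_mul//; move: ('D_w a p) ('D_w b p) (a p) (b p) => *.
by ring.
Qed.

Lemma derive2_sqr_mul (a b : V -> R) (w p : V) :
  class_C 2 A a -> class_C 2 A b -> A p ->
  'D_w ('D_w (fun q => a q ^+ 2 * b q)) p =
  a p * (4 * 'D_w a p * 'D_w b p + a p * 'D_w ('D_w b) p)
  + 2 * b p * ('D_w a p ^+ 2 + a p * 'D_w ('D_w a) p).
Proof.
move=> aC bC Ap.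
have ad q : A q -> differentiable a q by move=> Aq; exact: class_C_diff aC Aq.
have bd q : A q -> differentiable b q by move=> Aq; exact: class_C_diff bC Aq.
have aDd : differentiable ('D_w a) p by have [_ /(_ w)[+ _]] := aC; exact.
have bDd : differentiable ('D_w b) p by have [_ /(_ w)[+ _]] := bC; exact.
(* The square is split into nested binary products, so that the second differentiation is again by
   the product rule. *)
rewrite (derive_ext w (g := fun q =>
  2 * (a q * ('D_w a q * b q)) + a q ^+ 2 * 'D_w b q) _ Ap); last first.
  by move=> q Aq; rewrite derive_sqr_mul; [rewrite !mulrA|exact: ad|exact: bd].
have d1 : differentiable (fun q => 'D_w a q * b q) p.
  by apply: differentiableM => //; exact: bd.
have d2 : differentiable (fun q => a q * ('D_w a q * b q)) p.
  by apply: differentiableM => //; exact: ad.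
have d3 : differentiable (fun q => a q ^+ 2 * 'D_w b q) p.
  apply: differentiableM => //.
  rewrite (_ : (fun q => a q ^+ 2) = (fun q => a q * a q))//.
  by apply: differentiableM; exact: ad.
have d4 : differentiable (fun q => 2 * (a q * ('D_w a q * b q))) p.
  by apply: differentiableM => //; exact: differentiable_cst.
have dD := deriveD (diff_derivable (v := w) d4) (diff_derivable (v := w) d3).
apply: (etrans dD).
rewrite (derive_mul w (differentiable_cst (2 : R) p) d2).
rewrite (derive_cst (2 : R)) derive_mul//; last exact: ad.
rewrite derive_mul//; last exact: bd.
rewrite derive_sqr_mul//; last exact: ad.
move: ('D_w ('D_w a) p) ('D_w ('D_w b) p) ('D_w a p) ('D_w b p) (a p) (b p) => *.
by ring.
Qed.

End OpenDomain.

Lemma not_free3_orthonormal (R : realType) (n : nat) (x y z : 'rV[R]_n) :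
  dot x x = 1 -> dot y y = 1 -> dot x y = 0 -> dot z y = 0 ->
  ~~ free [:: x; y; z] -> z = dot z x *: x.
Proof.
(* Moving [z] to the front makes [free_cons] offer three cases: [z] in the span of [x] and [y], [x]
   a multiple of [y], or [y] zero. Orthonormality excludes the last two, and in the first [z] has no
   [y]-component. *)
move=> xx yy xy zy; rewrite (@perm_free _ _ [:: x; y; z] [:: z; x; y]); last first.
  by rewrite (perm_catC [:: x; y] [:: z]).
rewrite !free_cons nil_free span_nil andbT !negb_and !negbK memv0.
case/or3P => [|/[!span_seq1]/vlineP[c xE]|/eqP y0].
- rewrite span_cons span_seq1 => /memv_addP[_ /vlineP[a ->] [_ /vlineP[b ->] zE]].
  have b0 : b = 0 by move: zy; rewrite zE !dotE xy yy mulr0 add0r mulr1.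
  by move: zE; rewrite b0 scale0r addr0 => ->; rewrite dotZl xx mulr1.
- move: xy; rewrite xE dotZl yy mulr1 => c0.
  by move: xx; rewrite xE c0 scale0r dot0l => /eqP; rewrite eq_sym oner_eq0.
- by move: yy; rewrite y0 dot0l => /eqP; rewrite eq_sym oner_eq0.
Qed.

(** The quotient of the determinants of the second and first fundamental forms; the minus sign of
    the shape operator disappears because the matrices are 2 by 2. *)
Lemma det_shape_operator (R : realType) (Omega xi : 'rV[R]_2 -> 'rV[R]_4)
    (p : 'rV[R]_2) :
  differentiable Omega p -> differentiable xi p ->
  \det (shape_operator Omega xi p) =
  (dot (Du xi p) (Du Omega p) * dot (Dv xi p) (Dv Omega p)
   - dot (Du xi p) (Dv Omega p) * dot (Dv xi p) (Du Omega p))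
  / (dot (Du Omega p) (Du Omega p) * dot (Dv Omega p) (Dv Omega p)
     - dot (Du Omega p) (Dv Omega p) * dot (Dv Omega p) (Du Omega p)).
Proof.
move=> Od xd; have JE (f g : 'rV[R]_2 -> 'rV[R]_4) :
    differentiable f p -> differentiable g p ->
    'J f p *m ('J g p)^T = \matrix_(i < 2, j < 2)
      dot ('D_(delta_mx 0 (inord i)) f p) ('D_(delta_mx 0 (inord j)) g p).
  have JE1 (h : 'rV[R]_2 -> 'rV[R]_4) i k : differentiable h p ->
      'J h p i k = 'D_(delta_mx 0 i) h p 0 k.
    by move=> hd; rewrite deriveEjacobian// -rowE [RHS]mxE.
  move=> fd gd; apply/matrixP => i j; rewrite [LHS]mxE [RHS]mxE !inord_val.
  apply: eq_bigr => k _; rewrite [X in _ * X]mxE.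
  by congr (_ * _); exact: JE1.
have i0 : inord 0 = 0 :> 'I_2 by apply/val_inj; rewrite /= inordK.
have i1 : inord 1 = 1 :> 'I_2 by apply/val_inj; rewrite /= inordK.
have detN (A G A' G' : 'M[R]_2) : A = A' -> G = G' ->
    \det (- (A *m invmx G)) = \det A' / \det G'.
  by move=> -> ->; rewrite -scaleN1r detZ sqrrN expr1n mul1r det_mulmx det_inv.
apply: (etrans (detN _ _ _ _ (JE _ _ xd Od) (JE _ _ Od Od))).
rewrite (det_nat2 (fun i j =>
  dot ('D_(delta_mx 0 (inord i)) xi p) ('D_(delta_mx 0 (inord j)) Omega p))).
rewrite (det_nat2 (fun i j =>
  dot ('D_(delta_mx 0 (inord i)) Omega p) ('D_(delta_mx 0 (inord j)) Omega p))).
by rewrite !i0 !i1.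
Qed.

(** * The soliton surface *)

Section Soliton.
Context {R : realType} (U : set 'rV[R]_2)
    (Omega T E D N : 'rV[R]_2 -> 'rV[R]_4) (kappa sigma tau : 'rV[R]_2 -> R).
Hypothesis U_open : open U.
Hypothesis Omega_smooth : class_C 5 U Omega.
Hypothesis N_smooth : class_C 3 U N.
Hypothesis Omega_BDR : Betchov_Da_Rios U Omega.
Hypothesis frame : ED2_frame_field U Omega T E D N kappa sigma tau.
Hypothesis kappa_neq0 : forall p, U p -> kappa p != 0.
Hypothesis tau_neq0 : forall p, U p -> tau p != 0.

(** * Regularity inherited from [Omega] and [N] *)

Let Ou_smooth : class_C 4 U (Du Omega).
Proof. by have [_] := Omega_smooth; apply. Qed.

Let Ouu_smooth : class_C 3 U (Du (Du Omega)).
Proof. by have [_] := Ou_smooth; apply. Qed.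

Let Nu_smooth : class_C 2 U (Du N).
Proof. by have [_] := N_smooth; apply. Qed.

Let Omega_diff p : U p -> differentiable Omega p.
Proof. exact: class_C_diff Omega_smooth. Qed.

Let Ou_diff p : U p -> differentiable (Du Omega) p.
Proof. exact: class_C_diff Ou_smooth. Qed.

Let N_diff p : U p -> differentiable N p.
Proof. exact: class_C_diff N_smooth. Qed.

(** * The unit normal and the curvature [kappa] *)

Lemma dot_Ou_Ou p : U p -> dot (Du Omega p) (Du Omega p) = 1.
Proof. by move=> Up; rewrite -(ed2_T frame Up); exact: (ed2_unit_speed frame). Qed.

Lemma normal_orthonormal p : U p ->
  dot (N p) (N p) = 1 /\ dot (N p) (Du Omega p) = 0.
Proof.
move=> Up; have [M [nu [Mnu MN]]] := ed2_N frame (p 0 1).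
have [_ NE] := MN p Up erefl; rewrite NE.
apply: hypersurface_normal_orthogonal Mnu (Omega_diff Up) _.
have Ut : \forall t \near (0 : R), U (p + t *: delta_mx 0 0).
  have lc : {for (0 : R),
      continuous (fun t : R => p + t *: (delta_mx 0 0 : 'rV[R]_2))}.
    by apply: cvgD; [exact: cvg_cst|apply: cvgZl; exact: cvg_id].
  by apply: lc; rewrite scale0r addr0; exact: open_nbhs_nbhs.
(* Moving in the u-direction leaves the coordinate v unchanged, so the curve stays in the
   hypersurface chosen for [p 0 1]. *)
by apply: filterS Ut => t Ut; have [] := MN _ Ut; rewrite ?mxE ?mulr0 ?addr0.
Qed.

Let NN p (Up : U p) := (normal_orthonormal Up).1.
Let NT p (Up : U p) := (normal_orthonormal Up).2.

Lemma dot_Ouu_Ou p : U p -> dot (Du (Du Omega) p) (Du Omega p) = 0.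
Proof. by move=> Up; exact: (derive_dot_self U_open _ dot_Ou_Ou Up (Ou_diff Up)). Qed.

(** Unit speed makes Omega_uu orthogonal to T, so linear dependence leaves only its N-component,
    which is [kappa] by definition. *)
Lemma OuuE p : U p -> Du (Du Omega) p = kappa p *: N p.
Proof.
move=> Up; rewrite (ed2_kappa frame Up).
rewrite [Du T p](derive_ext U_open _ (ed2_T frame) Up) -/(Du _ _).
apply: not_free3_orthonormal (NN Up) (dot_Ou_Ou Up) (NT Up) (dot_Ouu_Ou Up) _.
by rewrite -(ed2_T frame Up); exact: (ed2_dependent frame).
Qed.

Lemma kappa_smooth : class_C 3 U kappa.
Proof.
apply: (class_C_ext U_open _ (class_C_dot U_open Ouu_smooth N_smooth)) => p Up.
by rewrite OuuE// dotZl NN// mulr1.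
Qed.

Let kappa_diff p : U p -> differentiable kappa p.
Proof. exact: class_C_diff kappa_smooth. Qed.

Lemma dot_Nu_N p : U p -> dot (Du N p) (N p) = 0.
Proof. by move=> Up; exact: (derive_dot_self U_open _ NN Up (N_diff Up)). Qed.

Lemma dot_Nu_T p : U p -> dot (Du N p) (Du Omega p) = - kappa p.
Proof.
move=> Up; have := derive_dot_cst U_open (delta_mx 0 0) NT Up (N_diff Up) (Ou_diff Up).
by rewrite -!/(Du _ _) OuuE// dotZr NN// mulr1.
Qed.

Lemma OuuuE p : U p ->
  Du (Du (Du Omega)) p = Du kappa p *: N p + kappa p *: Du N p.
Proof.
move=> Up; rewrite /Du (derive_ext U_open _ OuuE Up).
by rewrite deriveZ_rV//; [exact: kappa_diff|exact: N_diff].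
Qed.

(* The part of Omega_uuu orthogonal to N and T, which E normalizes. *)
Let w p := kappa p *: (Du N p + kappa p *: Du Omega p).

(** In Omega_uuu = kappa_u N + kappa N_u, removing the N-component deletes the first term, and
    removing the T-component adds kappa^2 T because <N_u, T> = - kappa. *)
Lemma EwE p : U p -> w p != 0 /\ E p = normalize (w p).
Proof.
move=> Up; have := ed2_E frame Up; rewrite OuuuE//= (ed2_T frame Up).
suff -> : forall a k : R, forall n nu t : 'rV[R]_4,
    dot n n = 1 -> dot n t = 0 -> dot nu n = 0 -> dot nu t = - k ->
    a *: n + k *: nu - dot (a *: n + k *: nu) n *: n
      - dot (a *: n + k *: nu) t *: t = k *: (nu + k *: t).
- by [].
- exact: NN.
- exact: NT.
- exact: dot_Nu_N.
- exact: dot_Nu_T.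
move=> a k n nu t nn nt nun nut; rewrite !dotE nn nt nun nut.
by apply/rowP => i; rewrite !mxE; ring.
Qed.

(** * The length of [w], and the smoothness of [E] and [tau] *)

Let s p := Num.sqrt (dot (w p) (w p)).

Let w_smooth : class_C 2 U w.
Proof.
have kC := class_C_le (isT : (2 <= 3)%N) kappa_smooth.
have TC := class_C_le (isT : (2 <= 4)%N) Ou_smooth.
apply: (class_CZ U_open kC); apply: (class_CD U_open Nu_smooth).
exact: (class_CZ U_open kC TC).
Qed.

Let s_gt0 p : U p -> 0 < s p.
Proof. by move=> Up; rewrite sqrtr_gt0; apply: dot_gt0; have [] := EwE Up. Qed.

Let s_smooth : class_C 2 U s.
Proof.
apply: (class_C_sqrt U_open _ (class_C_dot U_open w_smooth w_smooth)) => p Up.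
by apply: dot_gt0; have [] := EwE Up.
Qed.

Let E_smooth : class_C 2 U E.
Proof.
have sV : class_C 2 U (fun p => (s p)^-1).
  by apply: (class_CV U_open _ s_smooth) => p Up; rewrite gt_eqF// s_gt0.
apply: (class_C_ext U_open _ (class_CZ U_open sV w_smooth)) => p Up.
by have [_ ->] := EwE Up.
Qed.

Let E_diff p : U p -> differentiable E p.
Proof. exact: class_C_diff E_smooth. Qed.

Let wE p : U p -> w p = s p *: E p.
Proof.
move=> Up; have [_ ->] := EwE Up.
by rewrite /normalize -/(s p) scalerA divff ?scale1r// gt_eqF// s_gt0.
Qed.

Let EE p : U p -> dot (E p) (E p) = 1.
Proof. by move=> Up; have [w0 ->] := EwE Up; exact: dot_normalize. Qed.

Let EN p : U p -> dot (E p) (N p) = 0.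
Proof.
move=> Up; apply: (mulfI (lt0r_neq0 (s_gt0 Up))); rewrite -dotZl -wE// mulr0.
rewrite dotZl dotDl dotZl dot_Nu_N// dotC NT//.
by rewrite mulr0 addr0 mulr0.
Qed.

Let ET p : U p -> dot (E p) (Du Omega p) = 0.
Proof.
move=> Up; apply: (mulfI (lt0r_neq0 (s_gt0 Up))); rewrite -dotZl -wE// mulr0.
by rewrite dotZl dotDl dotZl dot_Nu_T// dot_Ou_Ou// mulr1 addNr mulr0.
Qed.

(** The length is <w, E> = kappa <N_u, E>, since E is orthogonal to T; differentiating <E, N> = 0
    turns <N_u, E> into - tau. *)
Let sE p : U p -> s p = - (kappa p * tau p).
Proof.
move=> Up; have : dot (w p) (E p) = s p by rewrite wE// dotZl EE// mulr1.
rewrite dotZl dotDl dotZl [dot (Du Omega p) _]dotC ET// mulr0 addr0 => <-.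
rewrite (ed2_tau frame Up) -mulrN; congr (_ * _).
have dEN := derive_dot_cst U_open (delta_mx 0 0) EN Up (E_diff Up) (N_diff Up).
by rewrite [dot (Du E p) _]dEN opprK dotC.
Qed.

(** The frame equation for N_u multiplied by [kappa], obtained by comparing the definition of [w]
    with [wE]. *)
Let kappa_Nu p : U p ->
  kappa p *: Du N p = - (kappa p * tau p) *: E p - kappa p ^+ 2 *: Du Omega p.
Proof.
by move=> Up; rewrite -sE// -wE// /w scalerDr scalerA -expr2 addrK.
Qed.

(** The formula <E_u, N> would lose one derivative of E. Writing tau as - s / kappa keeps class C^2,
    as the second derivative of [tau] in the curvature requires. *)
Let tau_smooth : class_C 2 U tau.
Proof.
have kV : class_C 2 U (fun p => (kappa p)^-1).
  by apply: (class_CV U_open kappa_neq0); exact: class_C_le kappa_smooth.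
have skC := class_CM U_open s_smooth kV.
apply: (class_C_ext U_open _ (class_CN U_open skC)) => p Up.
by rewrite sE// mulNr opprK mulrC mulKf// kappa_neq0.
Qed.

(** * The velocity Omega_v = g D and the derivative of [D] *)

Let g p := kappa p ^+ 2 * tau p.

Let g_neq0 p : U p -> g p != 0.
Proof. by move=> Up; rewrite mulf_neq0 ?expf_neq0 ?kappa_neq0 ?tau_neq0. Qed.

Let DE p : U p -> D p = cross3 (N p) (Du Omega p) (E p).
Proof. by move=> Up; rewrite (ed2_D frame Up) (ed2_T frame Up). Qed.

Lemma OvE p : U p -> Dv Omega p = g p *: D p.
Proof.
move=> Up; rewrite Omega_BDR// OuuuE// OuuE// kappa_Nu// DE//.
rewrite addrA addrAC -scaleNr cross3_swap_combination.
by rewrite mulrN opprK mulrA -expr2.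
Qed.

Let Ov_smooth : class_C 4 U (Dv Omega).
Proof. by have [_] := Omega_smooth; apply. Qed.

Let g_smooth : class_C 2 U g.
Proof.
have kC := class_C_le (isT : (2 <= 3)%N) kappa_smooth.
have kkC := class_CM U_open kC kC.
apply: (class_C_ext U_open _ (class_CM U_open kkC tau_smooth)) => p Up.
by rewrite /g expr2.
Qed.

(** [D] is recovered as Omega_v / g. *)
Let D_smooth : class_C 2 U D.
Proof.
have gV := class_CV U_open g_neq0 g_smooth.
have OC := class_C_le (isT : (2 <= 4)%N) Ov_smooth.
apply: (class_C_ext U_open _ (class_CZ U_open gV OC)) => p Up.
by rewrite OvE// scalerA mulVf ?scale1r// g_neq0.
Qed.

Let D_diff p : U p -> differentiable D p.
Proof. exact: class_C_diff D_smooth. Qed.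

Let g_diff p : U p -> differentiable g p.
Proof. exact: class_C_diff g_smooth. Qed.

Let DD p : U p -> dot (D p) (D p) = 1.
Proof.
move=> Up; rewrite DE// dot_cross3_cross3 NN// dot_Ou_Ou// EE// NT//.
rewrite (dotC (N p)) EN// (dotC (Du Omega p)) ET//.
by rewrite !mul0r !subr0 expr0n /= subr0 !mulr1 addr0.
Qed.

Let ND p : U p -> dot (N p) (D p) = 0.
Proof. by move=> Up; rewrite DE//; have [] := dot_cross3l (N p) (Du Omega p) (E p). Qed.

Let TD p : U p -> dot (Du Omega p) (D p) = 0.
Proof. by move=> Up; rewrite DE//; have [] := dot_cross3l (N p) (Du Omega p) (E p). Qed.

Let ED p : U p -> dot (E p) (D p) = 0.
Proof. by move=> Up; rewrite DE//; have [] := dot_cross3l (N p) (Du Omega p) (E p). Qed.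

Let NuD p : U p -> dot (Du N p) (D p) = 0.
Proof.
move=> Up; apply: (mulfI (kappa_neq0 Up)); rewrite -dotZl kappa_Nu//.
by rewrite dotDl dotNl !dotZl ED// TD// !mulr0 subr0.
Qed.

(** The components of D_u along T, D and N vanish, by T_u = kappa N, by |D| = 1 and by <N_u, D> = 0;
    the one along E is - <E_u, D>. *)
Lemma DuE p : U p -> Du D p = - sigma p *: E p.
Proof.
move=> Up; pose e (i : 'I_4) := nth 0 [:: Du Omega p; E p; D p; N p] i.
have eo i j : dot (e i) (e j) = (i == j)%:R.
  have OO := dot_Ou_Ou Up.
  rewrite /e; case: i => [[|[|[|[|]]]] ?] //; case: j => [[|[|[|[|]]]] ?] //=;
    by rewrite ?OO ?EE ?DD ?NN ?ET ?NT ?TD ?ED ?ND ?EN // dotC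
      ?ET ?NT ?TD ?ED ?ND ?EN.
have dDN := derive_dot_cst U_open (delta_mx 0 0) ND Up (N_diff Up) (D_diff Up).
have dDT := derive_dot_cst U_open (delta_mx 0 0) TD Up (Ou_diff Up) (D_diff Up).
have dDE := derive_dot_cst U_open (delta_mx 0 0) ED Up (E_diff Up) (D_diff Up).
have DuD : dot (Du D p) (D p) = 0.
  exact: (derive_dot_self U_open _ DD Up (D_diff Up)).
rewrite -!/(Du _ _) in dDN dDT dDE.
have DuN : dot (Du D p) (N p) = 0.
  by apply/eqP; rewrite dotC -oppr_eq0 -dDN NuD.
have DuT : dot (Du D p) (Du Omega p) = 0.
  by apply/eqP; rewrite dotC -oppr_eq0 -dDT OuuE// dotZl ND// mulr0.
have DuE : dot (Du D p) (E p) = - sigma p.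
  by rewrite (ed2_sigma frame Up) [dot (Du E p) _]dDE opprK dotC.
rewrite (orthonormal_expansion (Du D p) eo) !big_ord_recl big_ord0 /e /=.
by rewrite DuN DuT DuE DuD !scale0r !addr0 add0r.
Qed.

(** * Derivatives of Omega_v in u, and exchange of partial derivatives *)

Lemma OvuE p : U p -> Du (Dv Omega) p = Du g p *: D p - (g p * sigma p) *: E p.
Proof.
move=> Up; rewrite {1}/Du (derive_ext U_open _ OvE Up) deriveZ_rV; last 2 first.
- exact: g_diff.
- exact: D_diff.
by rewrite -!/(Du _ _) DuE// scalerA mulrN scaleNr.
Qed.

Let Ovu_diff p : U p -> differentiable (Du (Dv Omega)) p.
Proof. by have [_ /(_ (delta_mx 0 0))[+ _]] := Ov_smooth; exact. Qed.

(** Differentiating the scalar identity <Omega_vu, D> = g_u avoids any derivative of [sigma]: the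
    correction <Omega_vu, D_u> is g sigma^2. *)
Lemma dot_Ovuu_D p : U p ->
  dot (Du (Du (Dv Omega)) p) (D p) = Du (Du g) p - g p * sigma p ^+ 2.
Proof.
move=> Up; have gE q : U q -> dot (Du (Dv Omega) q) (D q) = Du g q.
  by move=> Uq; rewrite OvuE// dotDl dotNl !dotZl DD// ED// mulr1 mulr0 subr0.
have := derive_ext U_open (delta_mx 0 0) gE Up.
rewrite derive_dot; [|exact: Ovu_diff|exact: D_diff].
rewrite -!/(Du _ _) => <-; rewrite OvuE// DuE// !dotE EE// (dotC (D p)) ED//.
move: (dot _ _) (Du g p) (g p) (sigma p) => *; by ring.
Qed.

Lemma OuvE p : U p -> Dv (Du Omega) p = Du (Dv Omega) p.
Proof.
by move=> Up; apply: (derive_comm_rV _ _ U_open Up); exact: class_C_le Omega_smooth.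
Qed.

Lemma OuuvE p : U p -> Dv (Du (Du Omega)) p = Du (Du (Dv Omega)) p.
Proof.
move=> Up; rewrite [RHS](derive_ext U_open _ (fun q Uq => esym (OuvE Uq)) Up).
by apply: (derive_comm_rV _ _ U_open Up); exact: class_C_le Ou_smooth.
Qed.

(** Both sides are the D-component of Omega_uuv; in (kappa N)_v the term kappa_v N is orthogonal to
    D. *)
Lemma dot_Nv_D p : U p ->
  kappa p * dot (Dv N p) (D p) = Du (Du g) p - g p * sigma p ^+ 2.
Proof.
move=> Up; rewrite -dot_Ovuu_D// -OuuvE//.
rewrite [Dv (Du (Du Omega)) p](derive_ext U_open _ OuuE Up).
rewrite deriveZ_rV; [|exact: kappa_diff|exact: N_diff].
by rewrite -!/(Dv _ _) dotDl !dotZl ND// mulr0 add0r.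
Qed.

(** * The two shape operators and the curvature *)

Lemma det_shape_operator_N p : U p ->
  \det (shape_operator Omega N p) = sigma p ^+ 2 - Du (Du g) p / g p.
Proof.
move=> Up; rewrite det_shape_operator; [|exact: Omega_diff|exact: N_diff].
move: (dot_Nu_T Up) (NuD Up) (TD Up) (DD Up) (dot_Ou_Ou Up) (dot_Nv_D Up)
  (g_neq0 Up).
rewrite (OvE Up).
move: (Du N p) (Dv N p) (Du Omega p) (D p) (Du (Du g) p) (g p) (kappa p) (sigma p).
move=> nu nv t d guu G k sg nut nud td dd tt nvd G0.
(* Since <N_u, D> = 0, only - kappa g <N_v, D> survives in the numerator, over g^2; splitting off g
   sigma^2 from g_uu lets [nvd] substitute for the rest. *)
rewrite !dotE nut nud td dd tt -[guu](subrK (G * sg ^+ 2)) -nvd.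
by field.
Qed.

(** Here <E_u, T> = - kappa <E, N> = 0, so <E_v, Omega_v> does not contribute. Both off-diagonal
    entries equal g sigma: one by definition of [sigma], the other from <E_v, T> = - <E,
    Omega_uv>. *)
Lemma det_shape_operator_E p : U p ->
  \det (shape_operator Omega E p) = - sigma p ^+ 2.
Proof.
move=> Up; rewrite det_shape_operator; [|exact: Omega_diff|exact: E_diff].
have dET := derive_dot_cst U_open (delta_mx 0 0) ET Up (E_diff Up) (Ou_diff Up).
have dETv := derive_dot_cst U_open (delta_mx 0 1) ET Up (E_diff Up) (Ou_diff Up).
rewrite -/(Du _ _) -/(Du _ _) (OuuE Up) in dET.
rewrite -/(Dv _ _) -/(Dv _ _) (OuvE Up) (OvuE Up) in dETv.
move: dET dETv (ed2_sigma frame Up) (TD Up) (DD Up) (EE Up) (ED Up) (EN Up)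
  (dot_Ou_Ou Up) (g_neq0 Up).
rewrite (OvE Up).
move: (Du E p) (Dv E p) (E p) (N p) (Du Omega p) (D p) (Du g p) (g p) (kappa p)
  (sigma p).
move=> eu ev e n t d gu G k sg eut evt sgE td dd ee ed en tt G0.
rewrite !dotE eut evt !dotE td dd ee ed en tt -sgE.
by field.
Qed.

Lemma Gaussian_curvatureE p : U p ->
  Gaussian_curvature Omega E N p = - (Du (Du g) p / g p).
Proof.
move=> Up.
apply: etrans (congr2 +%R (det_shape_operator_E Up) (det_shape_operator_N Up)) _.
exact: addKr.
Qed.

Lemma Duu_g p : U p -> Du (Du g) p =
  kappa p * (4 * Du kappa p * Du tau p + kappa p * Du (Du tau) p)
  + 2 * tau p * (Du kappa p ^+ 2 + kappa p * Du (Du kappa) p).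
Proof.
move=> Up; apply: (derive2_sqr_mul U_open _ _ tau_smooth Up).
exact: class_C_le kappa_smooth.
Qed.

End Soliton.

Theorem theorem3 (R : realType) (U : set 'rV[R]_2)
    (Omega T E D N : 'rV[R]_2 -> 'rV[R]_4) (kappa sigma tau : 'rV[R]_2 -> R)
    (U_open : open U)
    (Omega_smooth : class_C 5 U Omega) (N_smooth : class_C 3 U N)
    (Omega_BDR : Betchov_Da_Rios U Omega)
    (frame : ED2_frame_field U Omega T E D N kappa sigma tau)
    (kappa_neq0 : forall p, U p -> kappa p != 0)
    (tau_neq0 : forall p, U p -> tau p != 0) :
  forall p, U p ->
    Gaussian_curvature Omega E N p =
    - ((kappa p * (4 * Du kappa p * Du tau p + kappa p * Du (Du tau) p)
        + 2 * tau p * ((Du kappa p) ^+ 2 + kappa p * Du (Du kappa) p))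
       / (kappa p ^+ 2 * tau p)).
Proof.
move=> p Up; apply: etrans (Gaussian_curvatureE U_open Omega_smooth N_smooth
  Omega_BDR frame kappa_neq0 tau_neq0 Up) _.
by rewrite (Duu_g U_open Omega_smooth N_smooth frame kappa_neq0 Up).
Qed.
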